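(* Let $K:\mathbb{N}_0\to\mathbb{N}_0$, $n\mapsto K_n$, be a scaling, let $\gamma_n$ be the number of deleted nodes, and let $P(n,K_n,\gamma_n)$ denote the probability that $\mathbb{H}(n;K_n,\gamma_n)$ is connected. (a) If $\gamma_n = o(\sqrt{n})$ and $K_n\ge 2$ for all $n$, then $\lim_{n\to\infty} P(n,K_n,\gamma_n)=1$. (b) If $\gamma_n=\Omega(\sqrt{n})$ and $\gamma_n=o(n)$, and for some sequence $\omega_n$ it holds that \[ K_n = r_2(\gamma_n)+\omega_n, \qquad\text{where } r_2(\gamma_n)=\frac{\log(\gamma_n)}{\log 2 + 1/2}, \] then $\lim_{n\to\infty} P(n,K_n,\gamma_n)=1$ provided $\lim_{n\to\infty}\omega_n=\infty$.
   Context: Random K-out graph $\mathbb{H}(n;K_n)$: on vertex set $V=\{v_1,\dots,v_n\}$ with labels $\mathcal{N}=\{1,\dots,n\}$, each node $v_i$ independently selects a set $\Gamma_{n,i}\subseteq \mathcal{N}\setminus\{i\}$ of $K_n$ distinct labels uniformly at random (the sets $\Gamma_{n,1},\dots,\Gamma_{n,n}$ are mutually independent). Distinct nodes $v_i,v_j$ are adjacent if $j\in\Gamma_{n,i}$ or $i\in\Gamma_{n,j}$ (undirected graph). The graph $\mathbb{H}(n;K_n,\gamma_n)$ is obtained by choosing a set $D\subset V$ of $\gamma_n$ nodes uniformly at random and deleting them: it has vertex set $R=V\setminus D$, and two distinct vertices of $R$ are adjacent iff they are adjacent in $\mathbb{H}(n;K_n)$. $\log$ is the natural logarithm; Landau notation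 $o,\Omega$ is as $n\to\infty$. *)

(* Defs.v *)
From HB Require Import structures.
From mathcomp Require Import all_boot all_order all_algebra.
From mathcomp Require Import all_classical all_reals all_analysis.
Set Implicit Arguments. Unset Strict Implicit. Unset Printing Implicit Defensive.
Import Order.TTheory GRing.Theory Num.Theory.

(* Vertices v_1..v_n are represented by 'I_n.  A selection profile
   G : {ffun 'I_n -> {set 'I_n}} gives G i = Gamma_{n,i}. *)

Definition kout_adj (n : nat) (G : {ffun 'I_n -> {set 'I_n}}) : rel 'I_n :=
  fun i j => (i != j) && ((j \in G i) || (i \in G j)).

Definition induced_adj (n : nat) (G : {ffun 'I_n -> {set 'I_n}})
  (Rs : {set 'I_n}) : rel 'I_n :=
  fun i j => [&& i \in Rs, j \in Rs & kout_adj G i j].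

Definition connected_on (n : nat) (G : {ffun 'I_n -> {set 'I_n}})
  (Rs : {set 'I_n}) : bool :=
  [forall u in Rs, forall v in Rs, connect (induced_adj G Rs) u v].

Definition valid_selection (n K : nat) (G : {ffun 'I_n -> {set 'I_n}}) : bool :=
  [forall i, (i \notin G i) && (#|G i| == K)].

(* sample space of H(n;K,gamma): (Gamma_1..Gamma_n, D) with |D| = gamma.
   All Gamma_i uniform and independent, D uniform and independent, so the
   joint law is the uniform law on this finite set. *)
Definition kout_outcomes (n K g : nat) :
  {set {ffun 'I_n -> {set 'I_n}} * {set 'I_n}} :=
  [set p : {ffun 'I_n -> {set 'I_n}} * {set 'I_n} | valid_selection K p.1 && (#|p.2| == g)].

Definition kout_connected_outcomes (n K g : nat) :
  {set {ffun 'I_n -> {set 'I_n}} * {set 'I_n}} :=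
  [set p in kout_outcomes n K g | connected_on p.1 (~: p.2)].

Definition Pconn (R : realType) (n K g : nat) : R :=
  (#|kout_connected_outcomes n K g|)%:R / (#|kout_outcomes n K g|)%:R.

(* Main.v *)
Require Import Defs.
From mathcomp Require Import all_boot all_order all_algebra.
Set Implicit Arguments. Unset Strict Implicit. Unset Printing Implicit Defensive.

(** Write m = n - g for the number of surviving vertices. If the surviving graph
    is disconnected, some set S of r <= m/2 survivors has no edge to the other
    survivors; summing over S and bounding the binomial ratios gives
      1 - P <= \sum_(1 <= r <= m/2) t_r ^ r,
      t_r = e^(g/n) (n/r) ((g + r)/n)^K,
    as soon as K >= 2.  When t_r <= 3/4 and t_r <= eps + del * r, the sum is at
    most 4 eps + 16 del.  In case (a), with s = g / sqrt n, one has
    t_r <= 5/4 (3 s + r/n).  In case (b) the hypotheses give n <= e^(3K), so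
    t_r is O(g/n) for r <= g, while t_r is O((3/4)^K) for r > g. *)

(** * Small cuts of the surviving graph and the selections compatible with them *)

Definition no_crossing (n : nat) (G : {ffun 'I_n -> {set 'I_n}})
    (Rs S : {set 'I_n}) : bool :=
  [forall i in S, forall j in Rs :\: S, (j \notin G i) && (i \notin G j)].

(** The component of a vertex [u] among the survivors is a cut, and so is its complement in [Rs],
    since [no_crossing] treats both sides alike. The smaller of the two is taken. *)
Lemma disconnected_small_cut (n : nat) (G : {ffun 'I_n -> {set 'I_n}})
    (Rs : {set 'I_n}) :
  ~~ connected_on G Rs ->
  exists S : {set 'I_n},
    [/\ S \subset Rs, 0 < #|S| <= #|Rs|./2 & no_crossing G Rs S].
Proof.
case/forall_inPn => u uR /forall_inPn[v vR nuv].
pose S0 := [set w in Rs | connect (induced_adj G Rs) u w].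
have uS : u \in S0 by rewrite inE uR connect0.
have vS : v \in Rs :\: S0 by rewrite !inE vR nuv.
have S0R : S0 \subset Rs by apply/subsetP => w; rewrite inE => /andP[].
have cut i j : i \in S0 -> j \in Rs :\: S0 ->
    (j \notin G i) && (i \notin G j).
  rewrite !inE => /andP[iR ui] /andP[+ jR]; rewrite jR /= => nuj.
  rewrite -negb_or; apply: contra nuj => ij.
  have [<- //|neq_ij] := eqVneq i j.
  apply: connect_trans ui (connect1 _).
  by rewrite /induced_adj /kout_adj iR jR neq_ij.
have [le|gt] := leqP #|S0| #|Rs|./2.
  exists S0; split=> //; first by rewrite le andbT; apply/card_gt0P; exists u.
  by apply/forall_inP => i iS; apply/forall_inP => j; apply: cut.
exists (Rs :\: S0); split; first exact: subsetDl.
  apply/andP; split; first by apply/card_gt0P; exists v.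
  rewrite cardsD (setIidPr S0R) leq_subLR.
  (* Rounding: [#|Rs|] is at most twice its half plus one, and [S0] has strictly more than half,
     which absorbs the one. *)
  by rewrite -{1}(odd_double_half #|Rs|) -addnn addnA leq_add2r;
    apply: leq_trans gt; case: (odd _).
apply/forall_inP => i iS; apply/forall_inP => j.
rewrite setDDr setDv set0U => /setIP[_ jS].
by rewrite andbC; apply: cut.
Qed.

Lemma cardsC1U (n : nat) (i : 'I_n) (A : {set 'I_n}) :
  i \notin A -> #|~: (i |: A)| = n.-1 - #|A|.
Proof. by move=> iA; rewrite cardsCs setCK cardsU1 iA card_ord subnDA subn1. Qed.

(** A cut constrains each selection separately: vertices of [S] avoid [Rs :\: S], the other
    survivors avoid [S], deleted vertices are free. The selections therefore lie in a product
    family, whose size is the bound. *)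
Lemma card_no_crossing (n K : nat) (Rs S : {set 'I_n}) : S \subset Rs ->
  #|[set G : {ffun 'I_n -> {set 'I_n}} |
      valid_selection K G && no_crossing G Rs S]| <=
  'C(n.-1 - (#|Rs| - #|S|), K) ^ #|S| * 'C(n.-1 - #|S|, K) ^ (#|Rs| - #|S|)
    * 'C(n.-1, K) ^ (n - #|Rs|).
Proof.
move=> SR.
(* The [set0] of the last branch gives all three branches the shape counted by [cardsC1U]. *)
pose ok i := if i \in S then ~: (i |: (Rs :\: S))
  else if i \in Rs then ~: (i |: S) else ~: (i |: set0).
pose F i := [set A : {set 'I_n} | A \subset ok i & #|A| == K].
have cF i : #|F i| = 'C(#|ok i|, K) by rewrite cards_draws.
have -> : 'C(n.-1 - (#|Rs| - #|S|), K) ^ #|S| *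
    'C(n.-1 - #|S|, K) ^ (#|Rs| - #|S|) * 'C(n.-1, K) ^ (n - #|Rs|)
    = #|family F|.
  rewrite card_family foldrE big_image /=.
  rewrite (bigID [in Rs]) /= (bigID [in S]) /=.
  have cD : #|Rs :\: S| = #|Rs| - #|S| by rewrite cardsD (setIidPr SR).
  congr (_ * _ * _).
  - rewrite (eq_bigr (fun=> 'C(n.-1 - (#|Rs| - #|S|), K))); last first.
      move=> i /andP[iR iS]; rewrite cF /ok iS cardsC1U ?cD //.
      by rewrite !inE iS.
    rewrite (eq_bigl [in S]); first by rewrite prod_nat_const.
    by move=> i; rewrite andbC; case: (boolP (i \in S)) => //= /(subsetP SR).
  - rewrite (eq_bigr (fun=> 'C(n.-1 - #|S|, K))); last first.
      by move=> i /andP[iR iS]; rewrite cF /ok (negPf iS) iR cardsC1U.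
    rewrite (eq_bigl [in Rs :\: S]); first by rewrite prod_nat_const cD.
    by move=> i; rewrite inE andbC.
  - rewrite (eq_bigr (fun=> 'C(n.-1, K))); last first.
      move=> i iR; rewrite cF /ok (negPf iR) ifN.
        by rewrite cardsC1U ?inE // cards0 subn0.
      by apply: contra iR => /(subsetP SR).
    rewrite (eq_bigl [in ~: Rs]); last by move=> i; rewrite inE.
    by rewrite prod_nat_const cardsCs setCK card_ord.
apply: subset_leq_card; apply/subsetP => G; rewrite inE => /andP[/forallP vG].
move=> /forall_inP cG; apply/familyP => i; rewrite inE.
have /andP[iG ->] := vG i; rewrite andbT /ok.
case: ifPn => iS; last case: ifPn => iR.
all: apply/subsetP => j jG; rewrite !inE negb_or.
all: have -> /= : j != i by apply: contraNneq iG => ji; rewrite -{1}ji.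
- apply/negP => /andP[jS jR].
  have /forall_inP/(_ j) := cG _ iS.
  by rewrite inE jS jR jG => /(_ isT).
- apply/negP => jS; have /forall_inP/(_ i) := cG _ jS.
  by rewrite inE iS iR jG andbF => /(_ isT).
- by [].
Qed.

Lemma card_disconnected_fixed (n K : nat) (Rs : {set 'I_n}) :
  #|[set G : {ffun 'I_n -> {set 'I_n}} |
      valid_selection K G && ~~ connected_on G Rs]| <=
  \sum_(1 <= r < #|Rs|./2.+1) 'C(#|Rs|, r) *
    ('C(n.-1 - (#|Rs| - r), K) ^ r * 'C(n.-1 - r, K) ^ (#|Rs| - r)
    * 'C(n.-1, K) ^ (n - #|Rs|)).
Proof.
pose f r := 'C(n.-1 - (#|Rs| - r), K) ^ r * 'C(n.-1 - r, K) ^ (#|Rs| - r)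
    * 'C(n.-1, K) ^ (n - #|Rs|).
pose P (S : {set 'I_n}) := (S \subset Rs) && (0 < #|S| <= #|Rs|./2).
pose cutG (S : {set 'I_n}) := [set G : {ffun 'I_n -> {set 'I_n}} |
      valid_selection K G && no_crossing G Rs S].
have le1 : #|[set G : {ffun 'I_n -> {set 'I_n}} |
      valid_selection K G && ~~ connected_on G Rs]|
    <= #|\bigcup_(S | P S) cutG S|.
  apply: subset_leq_card; apply/subsetP => G; rewrite inE => /andP[vG nc].
  have [S [SR Sr cS]] := disconnected_small_cut nc.
  by apply/bigcupP; exists S; rewrite ?/P ?SR // inE vG.
apply: leq_trans le1 _.
have le2 : #|\bigcup_(S | P S) cutG S| <= \sum_(S | P S) #|cutG S|.
  elim/big_rec2: _ => [|S y1 y2 _ h]; first by rewrite cards0.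
  by apply: leq_trans (leq_card_setU _ _) _; rewrite leq_add2l.
apply: leq_trans le2 _.
have le3 : \sum_(S | P S) #|cutG S| <= \sum_(S | P S) f #|S|.
  by apply: leq_sum => S /andP[SR _]; apply: card_no_crossing.
apply: leq_trans le3 _.
(* The cuts are grouped by size; [inord] is faithful here because [P] bounds the size by
   [#|Rs|./2]. *)
rewrite big_geq_mkord (partition_big
  (fun S : {set 'I_n} => inord #|S| : 'I_(#|Rs|./2.+1))
  (fun r : 'I__ => 0 < r)) /=; last first.
  by move=> S /and3P[_ S0 Sm]; rewrite inordK.
apply: leq_sum => r r0.
rewrite (eq_bigr (fun=> f r)); last first.
  by move=> S /andP[/and3P[_ S0 Sm] /eqP <-]; rewrite inordK.
rewrite sum_nat_cond_const leq_mul2r -cards_draws; apply/orP; right.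
apply: subset_leq_card; apply/subsetP => S; rewrite !inE.
move=> /andP[/and3P[-> S0 Sm] /eqP <-]; by rewrite inordK //=.
Qed.

(** * Size of the sample space and of its disconnected part *)

Lemma card_valid_selection (n K : nat) :
  #|[set G : {ffun 'I_n -> {set 'I_n}} | valid_selection K G]| = 'C(n.-1, K) ^ n.
Proof.
pose F (i : 'I_n) := [set A : {set 'I_n} | A \subset ~: (i |: set0) & #|A| == K].
rewrite -[in RHS](card_ord n) -prod_nat_const.
transitivity #|family F|.
  apply: eq_card => G; have inF i : (G i \in F i) = (i \notin G i) && (#|G i| == K).
    by rewrite inE setU0 -disjoints_subset disjoint_sym disjoints1.
  rewrite inE; apply/forallP/familyP => h i; have := h i.
    by rewrite -inF.
  by rewrite -inF.
rewrite card_family foldrE big_image /=; apply: eq_bigr => i _.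
by rewrite cards_draws cardsC1U ?inE // cards0 subn0 card_ord.
Qed.

Lemma card_kout_outcomes (n K g : nat) :
  #|kout_outcomes n K g| = 'C(n.-1, K) ^ n * 'C(n, g).
Proof.
rewrite -card_valid_selection -[in 'C(n, g)](card_ord n) -card_draws -cardsX.
by apply: eq_card => p; rewrite !inE.
Qed.

Lemma card_disconnected_outcomes (n K g : nat) :
  #|kout_outcomes n K g :\: kout_connected_outcomes n K g| <=
  'C(n, g) * \sum_(1 <= r < (n - g)./2.+1) 'C(n - g, r) *
    ('C(n.-1 - (n - g - r), K) ^ r * 'C(n.-1 - r, K) ^ (n - g - r)
    * 'C(n.-1, K) ^ (n - (n - g))).
Proof.
have -> : #|kout_outcomes n K g :\: kout_connected_outcomes n K g| =
  \sum_(D : {set 'I_n} | #|D| == g) #|[set G : {ffun 'I_n -> {set 'I_n}} |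
      valid_selection K G && ~~ connected_on G (~: D)]|.
  rewrite -sum1_card.
  under [RHS]eq_bigr => D _ do rewrite -sum1_card.
  (* Outcomes are counted slice by slice over the deleted set [D]; each slice obeys the same bound,
     as only the number of survivors enters. *)
  rewrite (exchange_big_dep predT) //= pair_big_dep /=.
  apply: eq_bigl => -[G D]; rewrite !inE /=.
  by case: valid_selection; case: eqP => //=; rewrite ?andbT ?andbF.
rewrite -[X in 'C(X, g)](card_ord n) -card_draws -sum_nat_const.
rewrite [leqRHS](eq_bigl (fun D : {set 'I_n} => #|D| == g)); last first.
  by move=> D; rewrite inE.
apply: leq_sum => D /eqP Dg.
have cD : #|~: D| = n - g by rewrite cardsCs setCK card_ord Dg.
by have := card_disconnected_fixed K (~: D); rewrite cD.
Qed.

Lemma kout_connected_sub (n K g : nat) :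
  kout_connected_outcomes n K g \subset kout_outcomes n K g.
Proof. by apply/subsetP => p; rewrite inE => /andP[]. Qed.

Lemma card_kout_connected (n K g : nat) :
  #|kout_connected_outcomes n K g| +
    #|kout_outcomes n K g :\: kout_connected_outcomes n K g| =
  #|kout_outcomes n K g|.
Proof.
by rewrite cardsD (setIidPr (kout_connected_sub n K g)) subnKC ?subset_leq_card
  ?kout_connected_sub.
Qed.

(* Imported only here: all_classical shadows the finset lemmas used above. *)
From mathcomp Require Import all_classical all_reals all_analysis.
From mathcomp Require Import ring lra zify.
Import Order.TTheory GRing.Theory Num.Theory.
Import numFieldNormedType.Exports.
Local Open Scope classical_set_scope.
Local Open Scope ring_scope.

(** * Union bound for the probability of disconnection *)

Section Estimates.
Variable R : realType.
Implicit Types (n K g m r a b : nat).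

Lemma Pconn_le1 n K g : Pconn R n K g <= 1.
Proof.
have AO := leq_addr #|kout_outcomes n K g :\: kout_connected_outcomes n K g|
  #|kout_connected_outcomes n K g|.
rewrite card_kout_connected in AO; rewrite /Pconn.
have [->|O0] := posnP #|kout_outcomes n K g|; first by rewrite invr0 mulr0.
by rewrite ler_pdivrMr ?ltr0n // mul1r ler_nat.
Qed.

(** On division by the size of the sample space, the choice of [D] and the free selections of the
    [g] deleted vertices cancel. *)
Lemma Pconn_union_bound n K g : (K < n)%N -> (g <= n)%N ->
  1 - Pconn R n K g <= \sum_(1 <= r < (n - g)./2.+1) 'C(n - g, r)%:R *
    (('C(n.-1 - (n - g - r), K)%:R / 'C(n.-1, K)%:R) ^+ r *
     ('C(n.-1 - r, K)%:R / 'C(n.-1, K)%:R) ^+ (n - g - r)) :> R.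
Proof.
move=> Kn gn.
have C0 : (0 < 'C(n.-1, K))%N by rewrite bin_gt0; case: n Kn {gn}.
have D0 : (0 < 'C(n, g))%N by rewrite bin_gt0.
have O0 : (0 < #|kout_outcomes n K g|)%N.
  by rewrite card_kout_outcomes muln_gt0 expn_gt0 C0 D0.
have -> : 1 - Pconn R n K g =
    #|kout_outcomes n K g :\: kout_connected_outcomes n K g|%:R
      / #|kout_outcomes n K g|%:R.
  rewrite /Pconn -{1}(@divff _ (#|kout_outcomes n K g|%:R : R)).
    by rewrite -mulrBl -{1}card_kout_connected natrD addrC addKr.
  by rewrite pnatr_eq0 -lt0n.
rewrite ler_pdivrMr ?ltr0n //.
apply: (@le_trans _ _ (('C(n, g) * \sum_(1 <= r < (n - g)./2.+1) 'C(n - g, r) *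
    ('C(n.-1 - (n - g - r), K) ^ r * 'C(n.-1 - r, K) ^ (n - g - r)
    * 'C(n.-1, K) ^ (n - (n - g))))%N%:R)).
  by rewrite ler_nat card_disconnected_outcomes.
rewrite card_kout_outcomes natrM natr_sum mulr_sumr mulr_suml.
rewrite le_eqVlt; apply/orP; left; apply/eqP; apply: eq_big_nat => r /andP[_ rm].
have {}rm : (r <= n - g)%N by lia.
have C0' : 'C(n.-1, K)%:R != 0 :> R by rewrite pnatr_eq0 -lt0n.
rewrite !natrM !natrX !expr_div_n.
have -> : ('C(n.-1, K)%:R : R) ^+ n = 'C(n.-1, K)%:R ^+ r *
   'C(n.-1, K)%:R ^+ (n - g - r) * 'C(n.-1, K)%:R ^+ (n - (n - g)).
  by rewrite -!exprD; congr (_ ^+ _); lia.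
by field; rewrite !expf_neq0.
Qed.

(** * Elementary bounds on binomial coefficients *)

(** Factor by factor, (a - j)/(b - j) <= a/b. In the product form a truncated [a - K] only makes the
    left side zero. *)
Lemma ffact_ratio_le a b K : (a <= b)%N ->
  (a ^_ K * b ^ K <= b ^_ K * a ^ K)%N.
Proof.
move=> ab; elim: K => [//|K IH].
rewrite !ffactnSr !expnSr.
have h : ((a - K) * b <= (b - K) * a)%N by nia.
by rewrite mulnACA [leqRHS]mulnACA leq_mul.
Qed.

Lemma bin_ratio_le a b K : (a <= b)%N -> (0 < b)%N -> (K <= b)%N ->
  'C(a, K)%:R / 'C(b, K)%:R <= (a%:R / b%:R) ^+ K :> R.
Proof.
move=> ab b0 Kb.
rewrite ler_pdivrMr ?ltr0n ?bin_gt0 // expr_div_n mulrAC ler_pdivlMr; last first.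
  by rewrite exprn_gt0 ?ltr0n.
rewrite -!natrX -!natrM ler_nat -(leq_pmul2r (fact_gt0 K)).
rewrite mulnAC bin_ffact -mulnA bin_ffact [leqRHS]mulnC.
exact: ffact_ratio_le.
Qed.

(** A weak Stirling bound; the induction step is (1 + 1/r)^r <= e. *)
Lemma exprn_le_expR_fact r : r%:R ^+ r <= expR r%:R * r`!%:R :> R.
Proof.
elim: r => [|r IH]; first by rewrite expr0 expR0 mul1r.
have [->|r0] := posnP r.
  by rewrite expr1 (_ : 1`! = 1%N) // mulr1; apply: le_trans (expR_ge1Dx _); lra.
have h : r.+1%:R ^+ r <= expR 1 * r%:R ^+ r :> R.
  rewrite -ler_pdivrMr ?exprn_gt0 ?ltr0n // -expr_div_n.
  have -> : r.+1%:R / r%:R = 1 + r%:R^-1 :> R.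
    by rewrite -natr1; field; rewrite pnatr_eq0 -lt0n.
  apply: (@le_trans _ _ (expR r%:R^-1 ^+ r)).
    by rewrite lerXn2r ?nnegrE ?addr_ge0 ?invr_ge0 ?ler0n ?expR_ge0 // expR_ge1Dx.
  by rewrite -expRM_natl mulfV // pnatr_eq0 -lt0n.
rewrite exprS factS natrM -[in expR _]natr1 expRD.
rewrite mulrCA ler_pM2l ?ltr0n //.
apply: le_trans h _; rewrite mulrC -mulrA [expR 1 * _]mulrC mulrA.
by rewrite ler_pM2r ?expR_gt0.
Qed.

Lemma bin_le_expR m r : (0 < r)%N ->
  'C(m, r)%:R <= (expR 1 * m%:R / r%:R) ^+ r :> R.
Proof.
move=> r0.
have f0 : 0 < r`!%:R :> R by rewrite ltr0n fact_gt0.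
rewrite -(ler_pM2r f0) -natrM bin_ffact expr_div_n exprMn -expRM_natl mulr1.
apply: (@le_trans _ _ (m%:R ^+ r)).
  rewrite -natrX ler_nat; elim: {r0 f0} r => [//|r IH].
  by rewrite ffactnSr expnSr leq_mul ?leq_subr.
rewrite mulrAC ler_pdivlMr ?exprn_gt0 ?ltr0n //.
rewrite [leRHS]mulrAC [leRHS]mulrC ler_wpM2l ?exprn_ge0 ?ler0n //.
exact: exprn_le_expR_fact.
Qed.

(** * Bounding the union sum *)

Lemma cut_term_le n K g r : (2 <= K < n)%N -> (g <= n)%N ->
  (0 < r <= (n - g)./2)%N ->
  'C(n - g, r)%:R *
    (('C(n.-1 - (n - g - r), K)%:R / 'C(n.-1, K)%:R) ^+ r *
     ('C(n.-1 - r, K)%:R / 'C(n.-1, K)%:R) ^+ (n - g - r)) <=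
  (expR (g%:R / n%:R) * (n%:R / r%:R) * ((g + r)%:R / n%:R) ^+ K) ^+ r :> R.
Proof.
move=> /andP[K2 Kn] gn /andP[r0 rm].
have n0 : 0 < n%:R :> R by rewrite ltr0n; lia.
have n0' : n%:R != 0 :> R by rewrite gt_eqF.
have n1 : 0 < n.-1%:R :> R by rewrite ltr0n; lia.
have r0' : 0 < r%:R :> R by rewrite ltr0n.
have h2 : (r.*2 <= n - g)%N by lia.
have inside : ('C(n.-1 - (n - g - r), K)%:R / 'C(n.-1, K)%:R) ^+ r <=
    (((g + r)%:R / n%:R) ^+ K) ^+ r :> R.
  rewrite lerXn2r ?nnegrE ?exprn_ge0 ?divr_ge0 ?ler0n //.
  apply: le_trans (bin_ratio_le _ _ _) _; [lia..|].
  rewrite lerXn2r ?nnegrE ?divr_ge0 ?ler0n // ler_pdivrMr // mulrAC.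
  by rewrite ler_pdivlMr // -!natrM ler_nat; nia.
have outside : ('C(n.-1 - r, K)%:R / 'C(n.-1, K)%:R) ^+ (n - g - r) <=
    expR (g%:R / n%:R - 1) ^+ r :> R.
  (* Two of the [K] factors suffice: each is at most 1 - r/n <= e^(-r/n). *)
  have rho : 'C(n.-1 - r, K)%:R / 'C(n.-1, K)%:R <= expR (- (r%:R / n%:R)) ^+ 2 :> R.
    apply: le_trans (bin_ratio_le _ _ _) _; [lia..|].
    apply: (@le_trans _ _ (((n.-1 - r)%:R / n.-1%:R) ^+ 2)).
      rewrite ler_wiXn2l ?divr_ge0 ?ler0n //.
      by rewrite ler_pdivrMr // mul1r ler_nat leq_subr.
    rewrite lerXn2r ?nnegrE ?divr_ge0 ?ler0n ?expR_ge0 //.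
    apply: le_trans (expR_ge1Dx _).
    rewrite ler_pdivrMr // -(ler_pM2r n0).
    have -> : (1 - r%:R / n%:R) * n.-1%:R * n%:R = (n%:R - r%:R) * n.-1%:R :> R.
      by field.
    by rewrite -natrB -?natrM ?ler_nat; [nia|lia].
  apply: (@le_trans _ _ ((expR (- (r%:R / n%:R)) ^+ 2) ^+ (n - g - r))).
    by rewrite lerXn2r ?nnegrE ?divr_ge0 ?ler0n ?exprn_ge0 ?expR_ge0.
  (* Since 2r <= n - g, also 2(n - g - r) >= n - g, so the total exponent is at most r(g/n - 1). *)
  rewrite -exprM -!expRM_natl ler_expR.
  have -> : (2 * (n - g - r))%:R * - (r%:R / n%:R) =
      r%:R * (- ((2 * (n - g - r))%:R / n%:R)) :> R by ring.
  rewrite ler_pM2l // lerNl opprB.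
  rewrite ler_pdivlMr // mulrBl mul1r divfK // -natrB // ler_nat; lia.
have binom := @bin_le_expR (n - g) r r0.
apply: le_trans (ler_pM _ _ binom (ler_pM _ _ inside outside)) _;
  rewrite ?mulr_ge0 ?exprn_ge0 ?divr_ge0 ?ler0n //.
rewrite -!exprMn lerXn2r ?nnegrE ?mulr_ge0 ?exprn_ge0 ?divr_ge0 ?expR_ge0 ?ler0n //.
rewrite expRB; set y := (_ / n%:R) ^+ K.
(* The e of the binomial bound cancels the 1/e of [outside]; this is why two selections per vertex
   are enough. *)
have -> : expR 1 * (n - g)%:R / r%:R * (y * (expR (g%:R / n%:R) / expR 1)) =
  expR (g%:R / n%:R) * ((n - g)%:R / r%:R) * y :> R.
  by field; rewrite !gt_eqF ?expR_gt0.
rewrite ler_wpM2r ?exprn_ge0 ?divr_ge0 ?ler0n // ler_wpM2l ?expR_ge0 //.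
by rewrite ler_pM2r ?invr_gt0 // ler_nat leq_subr.
Qed.

(** One factor of [t r ^+ r] is bounded linearly and the others by q = 3/4. The constants are the
    sums over r >= 1 of q^(r-1), which is 4, and of r q^(r-1), which is 16. *)
Lemma sum_expr_le_linear (t : nat -> R) (eps del : R) N : 0 <= eps -> 0 <= del ->
  (forall r, (0 < r < N.+1)%N -> 0 <= t r <= 3 / 4) ->
  (forall r, (0 < r < N.+1)%N -> t r <= eps + del * r%:R) ->
  \sum_(1 <= r < N.+1) t r ^+ r <= 4 * eps + 16 * del.
Proof.
move=> e0 d0 ht hl; set q := 3 / 4 in ht.
have q0 : 0 <= q by rewrite /q; lra.
have step : \sum_(1 <= r < N.+1) t r ^+ r <=
    \sum_(1 <= r < N.+1) (eps + del * r%:R) * q ^+ r.-1.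
  apply: ler_sum_nat => -[//|r] hr.
  have /andP[t0 tq] := ht _ hr.
  rewrite exprS /= ler_pM ?exprn_ge0 ?hl // lerXn2r ?nnegrE //.
apply: le_trans step _; rewrite big_add1 /= {ht hl}.
(* Closed form of the partial sum: the full series minus a nonnegative tail. *)
have -> : \sum_(0 <= r < N) (eps + del * r.+1%:R) * q ^+ r =
    4 * eps + 16 * del - (4 * eps + del * (4 * N%:R + 16)) * q ^+ N.
  elim: N => [|N IH]; first by rewrite big_nil expr0; ring.
  by rewrite big_nat_recr //= IH exprS -natr1 /q; field.
by rewrite gerBl mulr_ge0 ?addr_ge0 ?mulr_ge0 ?exprn_ge0 ?addr_ge0 ?mulr_ge0 ?ler0n.
Qed.

Lemma Pconn_ge n K g (eps del : R) : (2 <= K < n)%N -> (g <= n)%N ->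
  0 <= eps -> 0 <= del ->
  (forall r, (0 < r <= (n - g)./2)%N ->
    expR (g%:R / n%:R) * (n%:R / r%:R) * ((g + r)%:R / n%:R) ^+ K <= 3 / 4 :> R) ->
  (forall r, (0 < r <= (n - g)./2)%N ->
    expR (g%:R / n%:R) * (n%:R / r%:R) * ((g + r)%:R / n%:R) ^+ K <=
    eps + del * r%:R) ->
  1 - (4 * eps + 16 * del) <= Pconn R n K g.
Proof.
move=> hK gn e0 d0 h34 hlin; have /andP[_ Kn] := hK.
rewrite lerBlDr -lerBlDl; apply: le_trans (Pconn_union_bound Kn gn) _.
apply: le_trans (@sum_expr_le_linear (fun r => expR (g%:R / n%:R) *
  (n%:R / r%:R) * ((g + r)%:R / n%:R) ^+ K) _ _ _ e0 d0 _ _).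
- by apply: ler_sum_nat => r hr; apply: cut_term_le.
- by move=> r hr; rewrite h34 // andbT !mulr_ge0 ?exprn_ge0 ?expR_ge0.
- by move=> r hr; apply: hlin.
Qed.

Lemma expR_le54 (x : R) : x <= 5^-1 -> expR x <= 5 / 4.
Proof.
move=> x5; have := expR_ge1Dx (- x); rewrite expRN => h.
have h0 : 4 / 5 <= (expR x)^-1 by apply: le_trans h; lra.
by rewrite -[expR x]invrK -[leRHS]invrK lef_pV2 ?posrE ?invr_gt0 ?expR_gt0 //; lra.
Qed.

End Estimates.

(** * Explicit lower bounds in the two regimes of deletion *)

Lemma half_cut_bounds (n g r : nat) : (g <= n)%N -> (r <= (n - g)./2)%N ->
  [/\ (g + r <= n)%N, (r * 2 <= n)%N & ((g + r) * 2 <= n + g)%N].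
Proof. by move=> gn rm; split; lia. Qed.

Lemma Pconn_ge_few_deletions (R : realType) (n K g : nat) (s : R) :
  (2 <= K < n)%N -> 0 <= s <= 30^-1 -> g%:R <= s * Num.sqrt n%:R ->
  1 - (15 * s + 20 / n%:R) <= Pconn R n K g.
Proof.
move=> hK /andP[s0 s1] hg; have /andP[K2 Kn] := hK.
have n1 : 1 <= n%:R :> R by rewrite ler1n (leq_trans _ Kn).
have n0 : 0 < n%:R :> R by lra.
have r0 : 0 <= Num.sqrt n%:R :> R by apply: sqrtr_ge0.
have r2 : Num.sqrt n%:R ^+ 2 = n%:R :> R by rewrite sqr_sqrtr.
have r1 : 1 <= Num.sqrt n%:R :> R by rewrite -[leLHS]sqrtr1 ler_wsqrtr.
have g0 : 0 <= g%:R :> R by apply: ler0n.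
have gs : g%:R <= s * n%:R by rewrite -r2; nra.
have g2s : g%:R ^+ 2 <= s * n%:R.
  apply: (@le_trans _ _ ((s * Num.sqrt n%:R) ^+ 2)).
    by rewrite lerXn2r ?nnegrE ?mulr_ge0.
  by rewrite exprMn r2 ler_pM2r // expr2; nra.
have gn : (g <= n)%N by rewrite -(ler_nat R); nra.
have gn' : g%:R / n%:R <= s by rewrite ler_pdivrMr.
have he : expR (g%:R / n%:R) <= 5 / 4 :> R by apply: expR_le54; lra.
have t_le r : (0 < r <= (n - g)./2)%N ->
    expR (g%:R / n%:R) * (n%:R / r%:R) * ((g + r)%:R / n%:R) ^+ K <=
    5 / 4 * (3 * s + r%:R / n%:R) :> R.
  move=> /andP[rpos rm].
  have rr : 1 <= r%:R :> R by rewrite ler1n.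
  have y1 : ((g + r)%:R / n%:R) ^+ K <= ((g + r)%:R / n%:R) ^+ 2 :> R.
    rewrite ler_wiXn2l ?divr_ge0 ?ler0n // ler_pdivrMr // mul1r ler_nat.
    by case: (half_cut_bounds gn rm).
  apply: (@le_trans _ _ (5 / 4 * ((n%:R / r%:R) * ((g + r)%:R / n%:R) ^+ 2))).
    rewrite -mulrA ler_pM ?expR_ge0 ?mulr_ge0 ?divr_ge0 ?invr_ge0 ?exprn_ge0
      ?ler0n //.
    by rewrite ler_wpM2l ?divr_ge0 ?ler0n.
  rewrite ler_pM2l; last lra.
  (* Expanding the square leaves g^2/(nr) + 2g/n + r/n; the first two terms add up to at most 3s. *)
  have -> : n%:R / r%:R * ((g + r)%:R / n%:R) ^+ 2 =
      (g%:R ^+ 2 / n%:R) / r%:R + 2 * (g%:R / n%:R) + r%:R / n%:R :> R.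
    by rewrite natrD; field; rewrite !gt_eqF //; lra.
  rewrite lerD2r.
  have : (g%:R ^+ 2 / n%:R) / r%:R <= s.
    rewrite ler_pdivrMr; last lra.
    apply: (@le_trans _ _ s); first by rewrite ler_pdivrMr.
    by rewrite ler_peMr.
  by lra.
have -> : 15 * s + 20 / n%:R = 4 * (15 / 4 * s) + 16 * (5 / 4 / n%:R) :> R.
  by field; rewrite gt_eqF.
apply: Pconn_ge => //; first by lra.
(* The threshold 1/30 is chosen for this: 5/4 (3/30 + 1/2) = 3/4. *)
- move=> r hr; apply: le_trans (t_le r hr) _.
  have rn : r%:R / n%:R <= 2^-1 :> R.
    rewrite ler_pdivrMr // mulrC ler_pdivlMr // -natrM ler_nat.
    by have /andP[_ /(half_cut_bounds gn)[]] := hr.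
  by lra.
- move=> r hr; apply: le_trans (t_le r hr) _.
  by rewrite mulrDr [_ / n%:R * _]mulrAC -!mulrA lerD2r; lra.
Qed.

Lemma Pconn_ge_many_deletions (R : realType) (n K g : nat) :
  (2 <= K < n)%N -> n%:R <= expR (3 * K%:R) :> R ->
  4 * (3 / 4) ^+ K + 3 * expR 3 * (g%:R / n%:R) <= 3 / 4 :> R ->
  1 - 4 * (4 * (3 / 4) ^+ K + 3 * expR 3 * (g%:R / n%:R)) <= Pconn R n K g.
Proof.
move=> hK nK; set d := g%:R / n%:R; set eps := _ + _ => eps1.
have /andP[K2 Kn] := hK.
have n1 : 1 <= n%:R :> R by rewrite ler1n (leq_trans _ Kn).
have n0 : 0 < n%:R :> R by lra.
have d0 : 0 <= d by rewrite divr_ge0 ?ler0n.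
have q0 : 0 <= (3 / 4) ^+ K :> R by rewrite exprn_ge0 //; lra.
have e3 : 4 <= expR 3 :> R by apply: le_trans (expR_ge1Dx _); lra.
have ed0 : 0 <= expR 3 * d by rewrite mulr_ge0 ?expR_ge0.
have ed : 3 * expR 3 * d <= 3 / 4 by rewrite /eps in eps1; lra.
have d5 : d <= 5^-1 by nra.
have eps0 : 0 <= eps by rewrite /eps; lra.
have gd : g%:R = d * n%:R by rewrite divfK // gt_eqF.
have gn : (g <= n)%N by rewrite -(ler_nat R) gd; nra.
have he : expR d <= 5 / 4 by apply: expR_le54.
have t_le r : (0 < r <= (n - g)./2)%N ->
    expR d * (n%:R / r%:R) * ((g + r)%:R / n%:R) ^+ K <= eps.
  move=> /andP[rpos rm].
  have rr : 1 <= r%:R :> R by rewrite ler1n.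
  have y0 : 0 <= (g + r)%:R / n%:R :> R by rewrite divr_ge0 ?ler0n.
  apply: (@le_trans _ _ (5 / 4 * ((n%:R / r%:R) * ((g + r)%:R / n%:R) ^+ K))).
    by rewrite -mulrA ler_wpM2r ?mulr_ge0 ?exprn_ge0.
  have [rg|gr] := leqP r g.
  - have yd : (g + r)%:R / n%:R <= 2 * d.
      rewrite /d mulrA ler_pM2r ?invr_gt0 // natrD.
      by move: rg; rewrite -(ler_nat R); lra.
    (* Here n/r <= n <= (e^3)^K, so the product is at most (2 e^3 d)^K, with base below 1 by
       [ed]. *)
    have : n%:R / r%:R * ((g + r)%:R / n%:R) ^+ K <= 2 * expR 3 * d.
      apply: (@le_trans _ _ (expR 3 ^+ K * (2 * d) ^+ K)).
        rewrite ler_pM ?divr_ge0 ?exprn_ge0 ?ler0n //.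
          rewrite -expRM_natl [K%:R * _]mulrC; apply: le_trans _ nK.
          by rewrite ler_pdivrMr ?ler_peMr //; lra.
        by rewrite lerXn2r ?nnegrE //; lra.
      rewrite -exprMn mulrA [expR 3 * 2]mulrC -[leRHS]expr1.
      by rewrite ler_wiXn2l ?(ltnW K2) //; lra.
    by rewrite /eps; lra.
  - have y34 : (g + r)%:R / n%:R <= 3 / 4 :> R.
      rewrite ler_pdivrMr //.
      have : (g + r)%:R * 2 <= n%:R + g%:R :> R.
        by rewrite -natrM -natrD ler_nat; case: (half_cut_bounds gn rm).
      by rewrite gd; have := ler_wpM2r (ltW n0) d5; lra.
    have expK (x : R) : x ^+ K = x * x ^+ K.-1.
      by rewrite -exprS prednK // ltnW.
    have yK : ((g + r)%:R / n%:R) ^+ K.-1 <= (3 / 4) ^+ K.-1 :> R.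
      by rewrite lerXn2r ?nnegrE //; lra.
    (* One of the [K] factors absorbs n/r, as (g + r)/r <= 2 when g < r. *)
    have : n%:R / r%:R * ((g + r)%:R / n%:R) ^+ K <= 2 * (3 / 4) ^+ K.-1 :> R.
      rewrite expK mulrA ler_pM ?exprn_ge0 ?mulr_ge0 ?ler0n ?invr_ge0 //.
      have -> : n%:R / r%:R * ((g + r)%:R / n%:R) = (g + r)%:R / r%:R :> R.
        by field; rewrite !gt_eqF //; lra.
      rewrite ler_pdivrMr; last lra.
      by rewrite -natrM ler_nat mul2n -addnn leq_add2r ltnW.
    have -> : (3 / 4) ^+ K.-1 = 4 / 3 * (3 / 4) ^+ K :> R.
      by rewrite expK; field.
    by rewrite /eps; lra.
have -> : 4 * eps = 4 * eps + 16 * 0 by rewrite mulr0 addr0.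
apply: Pconn_ge => // r hr; last by rewrite mul0r addr0; apply: t_le.
exact: le_trans (t_le r hr) _.
Qed.

(** * Passage to the limit by squeezing *)

Theorem theorem3p2 (R : realType) (K gamma : nat -> nat) :
  (* the model is well defined: K_n <= n - 1 (for all large n) *)
  (\forall n \near \oo, (K n < n)%N) ->
  (* (a) *)
  ( ((fun n => (gamma n)%:R / Num.sqrt (n%:R : R)) @ \oo --> (0 : R)) ->
    (forall n, (2 <= K n)%N) ->
    (fun n => Pconn R n (K n) (gamma n)) @ \oo --> (1 : R) )
  /\
  (* (b) *)
  ( forall omega : nat -> R,
    (exists2 c : R, 0 < c &
       \forall n \near \oo, c * Num.sqrt (n%:R : R) <= (gamma n)%:R) ->
    ((fun n => (gamma n)%:R / (n%:R : R)) @ \oo --> (0 : R)) ->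
    (forall n, (K n)%:R = ln ((gamma n)%:R : R) / (ln 2 + 2^-1) + omega n) ->
    omega @ \oo --> +oo ->
    (fun n => Pconn R n (K n) (gamma n)) @ \oo --> (1 : R) ).
Proof.
move=> Kn; split=> [s0 K2 | omega [c c0 cg] g0 defK omega_oo].
- have inv0 : (fun n : nat => n%:R^-1 : R) @ \oo --> (0 : R).
    by rewrite -cvg_shiftS; exact: cvg_harmonic.
  apply: (@squeeze_cvgr _ _ _ _ (fun n => 1 - (15 *
    ((gamma n)%:R / Num.sqrt n%:R) + 20 * n%:R^-1)) (fun=> 1)); last first.
  + exact: cvg_cst.
  + rewrite -[X in _ --> X]subr0 -[X in _ --> _ - X](addr0 0).
    rewrite -[X in _ --> _ - (X + _)](mulr0 15) -[X in _ --> _ - (_ + X)](mulr0 20).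
    by apply: cvgB; [exact: cvg_cst|apply: cvgD; apply: cvgMr].
  + have s_small : \forall n \near \oo,
        `|(gamma n)%:R / Num.sqrt (n%:R : R)| < 30^-1.
      by move/cvgr0Pnorm_lt : s0; apply; rewrite invr_gt0.
    near=> n; rewrite Pconn_le1 andbT.
    have Knn : (K n < n)%N by near: n.
    have rn : 0 < Num.sqrt (n%:R : R) by rewrite sqrtr_gt0 ltr0n (leq_trans _ Knn).
    apply: Pconn_ge_few_deletions; first by rewrite K2.
      rewrite divr_ge0 ?ler0n ?sqrtr_ge0 //=.
      by apply/ltW/(le_lt_trans (ler_norm _)); near: n.
    by rewrite divfK // gt_eqF.
(* The constant 2/3 comes from ln 2 <= 1, hence ln 2 + 1/2 <= 3/2. *)
- have K_ge n : (0 < gamma n)%N -> 2 / 3 * ln ((gamma n)%:R : R) + omega n <= (K n)%:R.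
    move=> gn; rewrite defK lerD2r mulrC ler_wpM2l //.
      by rewrite ln_ge0 // ler1n.
    have ln2 : ln 2 <= 1 :> R.
      by have := @le_ln1Dx R 1; rewrite -[1 + 1]/(2%:R); apply; lra.
    have ln20 : 0 <= ln 2 :> R by rewrite ln_ge0 //; lra.
    by rewrite -[2 / 3]invf_div lef_pV2 ?posrE; lra.
  have gpos : \forall n \near \oo, (0 < gamma n)%N.
    near=> n; rewrite -(ltr0n R); apply: lt_le_trans (_ : c * Num.sqrt n%:R <= _).
      by rewrite mulr_gt0 // sqrtr_gt0 ltr0n; near: n; exact: nbhs_infty_gt.
    by near: n.
  (* As ln gamma >= 0 eventually, [K n] dominates [omega n]. *)
  have K_oo (N : nat) : \forall n \near \oo, (N <= K n)%N.
    near=> n; rewrite -(ler_nat R).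
    have gn : (0 < gamma n)%N by near: n.
    apply: le_trans (K_ge _ gn).
    have : N%:R <= omega n by near: n; move/cvgryPge : omega_oo; apply.
    have : 0 <= ln ((gamma n)%:R : R) by rewrite ln_ge0 // ler1n.
    by lra.
  have nK : \forall n \near \oo, n%:R <= expR (3 * (K n)%:R) :> R.
    near=> n.
    have gn : (0 < gamma n)%N by near: n.
    have n0 : 0 < n%:R :> R by rewrite ltr0n; near: n; exact: nbhs_infty_gt.
    (* By [K_ge], 3K >= 2 ln gamma + 3 omega >= ln n + 2 ln c + 3 omega, so [om] asks omega to
       outweigh the constant ln c. *)
    rewrite -ler_ln ?posrE ?expR_gt0 // expRK.
    have om : - (2 / 3 * ln c) <= omega n.
      by near: n; move/cvgryPge : omega_oo; apply.
    have : ln (c * Num.sqrt n%:R) <= ln ((gamma n)%:R : R).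
      by rewrite ler_ln ?posrE ?mulr_gt0 ?sqrtr_gt0 ?ltr0n //; near: n.
    rewrite lnM ?posrE ?sqrtr_gt0 //.
    have : ln (Num.sqrt n%:R ^+ 2) = ln (n%:R) :> R by rewrite sqr_sqrtr.
    rewrite lnXn ?sqrtr_gt0 // mulr2n.
    by have := K_ge _ gn; lra.
  pose eps n : R := 4 * (3 / 4) ^+ K n + 3 * expR 3 * ((gamma n)%:R / n%:R).
  have eps_cvg : eps @ \oo --> (0 : R).
    rewrite -[X in _ --> X]addr0 -[X in _ --> X + _](mulr0 4).
    rewrite -[X in _ --> _ + X](mulr0 (3 * expR 3)).
    apply: cvgD; apply: cvgMr => //.
    have Kinf : K @ \oo --> \oo by apply/cvgnyPge => N; exact: K_oo.
    apply: cvg_comp Kinf _.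
    by apply: cvg_expr; rewrite ger0_norm; lra.
  apply: (@squeeze_cvgr _ _ _ _ (fun n => 1 - 4 * eps n) (fun=> 1)); last first.
  + exact: cvg_cst.
  + rewrite -[X in _ --> X]subr0 -[X in _ --> _ - X](mulr0 4).
    by apply: cvgB; [exact: cvg_cst|apply: cvgMr].
  + have eps_small : \forall n \near \oo, `|eps n| < 3 / 4.
      by move/cvgr0Pnorm_lt : eps_cvg; apply; lra.
    near=> n; rewrite Pconn_le1 andbT.
    apply: Pconn_ge_many_deletions.
    * by apply/andP; split; near: n.
    * by near: n.
    * by apply/ltW/(le_lt_trans (ler_norm _)); near: n.
Unshelve. all: by end_near.
Qed.
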